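(* The following hold. (1) For an irreducible fraction $\frac rs$, $\mathcal S^\flat_{\frac rs}(q)$ is palindromic if and only if $r^2\equiv-1\pmod s$. (2) For an irreducible fraction $\frac rs$, $\mathcal R^\flat_{\frac rs}(q)$ is equivalent to a palindromic polynomial if and only if $s^2\equiv-1\pmod r$. (3) For an irreducible fraction $\frac rs>1$, the normalized Jones polynomial $J_{\frac rs}(q)$ is palindromic if and only if $s^2\equiv -1\pmod r$.
   Context: Irreducible fractions $\frac rs\in\mathbb{Q}$ are written with $s>0$. Each $\frac rs\in\mathbb Q$ has an even-length regular continued fraction $\frac rs=[a_1,\ldots,a_{2m}]=a_1+\cfrac{1}{a_2+\cfrac{1}{\ddots+\cfrac1{a_{2m}}}}$, unique under the conventions: if $\frac rs>0$, then $a_1\ge 0$ and $a_i\ge 1$ for $i\ge2$; if $\frac rs<0$, then $a_1\le 0$ and $a_i\le -1$ for $i\ge 2$; and $\frac01=[-1,1]$. Let $q$ be a formal parameter, $R_q=\begin{pmatrix} q&1\\0&1\end{pmatrix}$, $L_q=\begin{pmatrix}1&0\\1&q^{-1}\end{pmatrix}$, and $M_q(a_1,\ldots,a_{2m})=R_q^{a_1}L_q^{a_2}\cdots R_q^{a_{2m-1}}L_q^{a_{2m}}\in \mathrm{GL}(2,\mathbb Z[q^{\pm1}])$. Matrices act by fractional linear transformations. The left and right $q$-deformed rational numbers of $\frac rs=[a_1,\ldots,a_{2m}]$ are $\left[\frac rs\right]^\flat_q=M_q(a_1,\ldots,a_{2m})\left(\frac1{1-q}\right)$ and $\left[\frac rs\right]^\sharp_q=M_q(a_1,\ldots,a_{2m})\left(\frac10\right)$.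 They are written as $\left[\frac rs\right]^\flat_q=\frac{\mathcal R^\flat_{r/s}(q)}{\mathcal S^\flat_{r/s}(q)}$ and $\left[\frac rs\right]^\sharp_q=\frac{\mathcal R^\sharp_{r/s}(q)}{\mathcal S^\sharp_{r/s}(q)}$, where numerators lie in $\mathbb Z[q^{\pm1}]$ and denominators in $\mathbb Z[q]$, obtained by multiplying both entries of the vectors $M_q(a_1,\ldots,a_{2m})\begin{pmatrix}1\\1-q\end{pmatrix}$ and $M_q(a_1,\ldots,a_{2m})\begin{pmatrix}1\\0\end{pmatrix}$, respectively, by a common $\pm q^n$ so that $\mathcal S^\flat_{r/s}(0)=\mathcal S^\sharp_{r/s}(0)=1$. For an irreducible fraction $\alpha=\frac rs=[a_1,\ldots,a_{2m}]>1$, let $L(\alpha)$ be the associated rational (2-bridge) link in $\mathbb S^3$, given by the standard diagram with successive twist regions of $-a_1,a_2,-a_3,\ldots,-a_{2m-1},a_{2m}$ half twists, and let $V_{L(\alpha)}(t)$ be its Jones polynomial. The normalized Jones polynomial is $J_\alpha(q):=\pm t^{-h}V_{L(\alpha)}(t)|_{t=-q^{-1}}$, where $\pm t^h$ is the leading term of $V_{L(\alpha)}(t)$, so that $J_\alpha(q)\in\mathbb Z[q]$ has constant term $1$. By a known theorem of Morier-Genoud and Ovsienko, $J_\alpha(q)=q\,\mathcal R^\sharp_\alpha(q)+(1-q)\,\mathcal S^\sharp_\alpha(q)$; this formula may be taken as the definition of $J_\alpha(q)$. For $f,g\in\mathbb Z[q^{\pm1}]$, $f$ is equivalent to $g$ ($f\equiv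 g$) if $f=\pm q^n g$ for some $n\in\mathbb Z$ and some sign. A polynomial $f\in\mathbb Z[q]$ is palindromic if $f(q)=f(q)^\vee$, where $f(q)^\vee:=q^{\deg f}f(q^{-1})$. *)

(* Defs.v *)
From HB Require Import structures.
From mathcomp Require Import all_boot all_order all_algebra.
From mathcomp Require Import zify ring lra.

Set Implicit Arguments.
Unset Strict Implicit.
Unset Printing Implicit Defensive.
Import Order.TTheory GRing.Theory Num.Theory.
Local Open Scope ring_scope.

(* Since 0^-1 = 0, this is a_1 + 1/(a_2 + ... + 1/a_k). *)
Definition cf_val (a : seq int) : rat := foldr (fun c y => c%:~R + y^-1) 0 a.
Arguments cf_val : simpl never.

Lemma cf_val_cons c a : cf_val (c :: a) = c%:~R + (cf_val a)^-1.
Proof. by []. Qed.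

(* The even-length expansion of x. The sign conventions force it to be unique
   (even_cf_unique); for x != 0 they also exclude the empty sequence, whose
   value is 0. *)
Definition is_even_cf (x : rat) (a : seq int) : bool :=
  [&& ~~ odd (size a), cf_val a == x &
    if x == 0 then a == [:: -1; 1]
    else if 0 < x then (0 <= head 0 a) && all (fun c => 1 <= c) (behead a)
    else (head 0 a <= 0) && all (fun c => c <= -1) (behead a)].

Definition pos_cf (a : seq int) : bool :=
  [&& ~~ odd (size a), 0 <= head 0 a & all (fun c => 1 <= c) (behead a)].

Lemma pos_cf_cons2 c d a : pos_cf [:: c, d & a] =
  [&& 0 <= c, 1 <= d, all (fun c => 1 <= c) a & ~~ odd (size a)].
Proof.
rewrite /pos_cf /= negbK.
by case: odd; case: (0 <= c); case: (1 <= d); case: all.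
Qed.

Lemma pos_cf_exists_nat (r s : nat) : (0 < r)%N -> (0 < s)%N ->
  exists a, [/\ pos_cf a, a != [::], cf_val a = r%:R / s%:R
                & (s < r)%N -> 1 <= head 0 a].
Proof.
elim/ltn_ind: s r => s IH r r0 s0.
pose c := (r.-1 %/ s)%N; pose r1 := (r.-1 %% s).+1.
pose d := (s %/ r1)%N; pose s1 := (s %% r1)%N.
have Er : (r = c * s + r1)%N.
  by rewrite /r1 addnS -divn_eq prednK.
have r1s : (r1 <= s)%N by rewrite /r1 ltn_mod.
have Es : (s = d * r1 + s1)%N by rewrite -divn_eq.
have d0 : (1 <= d)%N by rewrite divn_gt0.
have s1r1 : (s1 < r1)%N by rewrite ltn_mod.
have c1 : (s < r)%N -> (1 <= c)%N.
  by move=> sr; rewrite divn_gt0 // -ltnS prednK.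
have r1N : r1%:R != 0 :> rat by rewrite pnatr_eq0.
have sN : s%:R != 0 :> rat by rewrite pnatr_eq0 -lt0n.
have EsR : s%:R = d%:R * r1%:R + s1%:R :> rat by rewrite -natrM -natrD -Es.
have main y : y^-1 = s1%:R / r1%:R ->
    c%:R + (d%:R + y^-1)^-1 = r%:R / s%:R :> rat.
  move=> ->.
  have -> : d%:R + s1%:R / r1%:R = s%:R / r1%:R :> rat.
    by rewrite EsR; field.
  by rewrite invf_div [in RHS]Er natrD natrM mulrDl mulfK.
have [s10|s1p] := posnP s1.
  exists [:: c%:Z; d%:Z]; split => //.
  - by rewrite pos_cf_cons2 /= !andbT lez_nat.
  - by rewrite /cf_val /= main // s10 mul0r invr0.
have s1s : (s1 < s)%N by exact: leq_trans s1r1 r1s.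
have [a [pa a0 va ha]] := IH s1 s1s r1 isT s1p.
exists [:: c%:Z, d%:Z & a]; split => //.
- rewrite pos_cf_cons2; apply/and4P; split => //; last by case/and3P: pa.
  case: a a0 ha pa {va} => //= h a _ ha /and3P[_ _ /= ->].
  by rewrite andbT ha.
- by rewrite /cf_val /= main // -/(cf_val a) va invf_div.
Qed.

Lemma cf_valN a : cf_val (map -%R a) = - cf_val a.
Proof.
elim: a => [|c a IH]; first by rewrite /cf_val /= oppr0.
by rewrite /cf_val /= -!/(cf_val _) IH invrN rmorphN -opprD.
Qed.

Lemma even_cf_exists (x : rat) : exists a, is_even_cf x a.
Proof.
have pos y : 0 < y -> exists a, pos_cf a /\ cf_val a = y.
  move=> y0; have ny : 0 < numq y by rewrite numq_gt0.
  have [a [pa _ va _]] := @pos_cf_exists_nat `|numq y| `|denq y|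
     ltac:(by rewrite absz_gt0 gt_eqF) ltac:(by rewrite absz_gt0 denq_neq0).
  exists a; split=> //; rewrite va -[RHS]divq_num_den.
  by rewrite !natr_absz !gtr0_norm.
case: (ltrgt0P x) => [x0|x0|->].
- have [a [/and3P[pa1 pa2 pa3] va]] := pos _ x0; exists a.
  by rewrite /is_even_cf pa1 va eqxx gt_eqF // x0 pa2.
- have [|a [/and3P[pa1 pa2 pa3] va]] := pos (- x); first by rewrite oppr_gt0.
  exists (map -%R a).
  rewrite /is_even_cf size_map pa1 cf_valN va opprK eqxx lt_eqF // ltNge ltW //=.
  apply/andP; split; first by case: (a) pa2 => //= h _; rewrite oppr_le0.
  by rewrite behead_map all_map; apply: sub_all pa3 => c /=; rewrite lerN2.
- by exists [:: -1; 1].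
Qed.

Definition even_cf (x : rat) : seq int := xchoose (even_cf_exists x).

Lemma even_cfP x : is_even_cf x (even_cf x).
Proof. exact: (xchooseP (even_cf_exists x)). Qed.


Lemma cf_val_ge1 (c : int) a : all (fun d : int => 1 <= d) (c :: a) -> 1 <= cf_val (c :: a).
Proof.
elim: a c => [|d a IH] c /= /andP[c1 h]; rewrite cf_val_cons.
  by rewrite /cf_val /= invr0 addr0 ler1z.
have := IH d h; move: (cf_val _) => y y1.
have y0 : 0 <= y^-1 by rewrite invr_ge0 (le_trans ler01).
have c0 : 1 <= c%:~R :> rat by rewrite ler1z.
lra.
Qed.

Lemma cf_val_tail a : all (fun d : int => 1 <= d) a -> ~~ odd (size a) ->
  0 <= (cf_val a)^-1 < 1.
Proof.
case: a => [|c [|d a]] //.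
move=> /= /andP[c1 h] _; have := cf_val_ge1 h.
rewrite [cf_val [:: c, d & a]]cf_val_cons.
move: (cf_val _) => y y1.
have y0 : 0 < y^-1 by rewrite invr_gt0 (lt_le_trans ltr01).
have c1' : 1 <= c%:~R :> rat by rewrite ler1z.
have z1 : 1 < c%:~R + y^-1 by lra.
have z0 := lt_trans ltr01 z1.
by rewrite invr_ge0 (ltW z0) invf_lt1 ?z1.
Qed.

Lemma pos_cf_inj a b : pos_cf a -> pos_cf b -> cf_val a = cf_val b -> a = b.
Proof.
have step c d e : 0 <= c -> 1 <= d -> all (fun d : int => 1 <= d) e ->
    ~~ odd (size e) ->
    [/\ Num.ceil (cf_val [:: c, d & e]) = c + 1,
        Num.floor (cf_val [:: c, d & e] - c%:~R)^-1 = d,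
        (cf_val [:: c, d & e] - c%:~R)^-1 - d%:~R = (cf_val e)^-1
      & 0 < cf_val [:: c, d & e]].
  move=> c0 d1 e1 e2; have /andP[v0 v1] := cf_val_tail e1 e2.
  rewrite !cf_val_cons [X in X - c%:~R]addrC addrK invrK.
  move: (cf_val e)^-1 v0 v1 => v v0 v1.
  have d1' : 1 <= d%:~R :> rat by rewrite ler1z.
  have c0' : 0 <= c%:~R :> rat by rewrite ler0z.
  have p0 : 0 < d%:~R + v by lra.
  have i0 : 0 < (d%:~R + v)^-1 by rewrite invr_gt0.
  have i1 : (d%:~R + v)^-1 <= 1 by rewrite invf_le1 //; lra.
  split; last by lra.
  - by apply: ceil_def; rewrite addrK rmorphD /= ; apply/andP; split; lra.
  - by apply: floor_def; rewrite rmorphD /=; apply/andP; split; lra.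
  - by rewrite addrC addKr.
have [n] := ubnP (size a); elim: n a b => // n IH a b.
case: a => [|c [|d a]] // an; case: b => [|c' [|d' b]] // pa pb.
- move: pb; rewrite pos_cf_cons2 => /and4P[h1 h2 h3 h4].
  have [_ _ _ +] := step c' d' b h1 h2 h3 h4.
  by move=> + vab; rewrite -vab ltxx.
- move: pa; rewrite pos_cf_cons2 => /and4P[h1 h2 h3 h4].
  have [_ _ _ +] := step c d a h1 h2 h3 h4.
  by move=> + vab; rewrite vab ltxx.
move: pa pb; rewrite !pos_cf_cons2 => /and4P[c0 d1 a1 a2] /and4P[c0' d1' b1 b2].
move=> vab.
have [ec ed ea _] := step c d a c0 d1 a1 a2.
have [ec' ed' eb _] := step c' d' b c0' d1' b1 b2.
have cc' : c = c' by apply: (addIr 1); rewrite -ec -ec' vab.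
have dd' : d = d' by rewrite -ed -ed' vab cc'.
have vv : cf_val a = cf_val b.
  by apply: invr_inj; rewrite -ea -eb vab cc' dd'.
have pos e : all (fun d : int => 1 <= d) e -> ~~ odd (size e) -> pos_cf e.
  move=> h ho; rewrite /pos_cf ho /=; case: e h {ho} => //= x e /andP[x1 ->].
  by rewrite andbT (le_trans ler01).
by rewrite cc' dd' (IH a b) //; [move: an => /= | exact: pos | exact: pos]; lia.
Qed.

Lemma even_cf_unique x a : is_even_cf x a -> a = even_cf x.
Proof.
suff inj b : is_even_cf x a -> is_even_cf x b -> a = b.
  by move=> ha; apply: inj ha (even_cfP x).
move=> /and3P[oa /eqP va ha] /and3P[ob /eqP vb hb].
case: ltrgt0P ha hb => [x0 /andP[a1 a2] /andP[b1 b2]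
                       |x0 /andP[a1 a2] /andP[b1 b2]|_ /eqP -> /eqP ->] //.
  by apply: pos_cf_inj; rewrite ?va ?vb // /pos_cf ?oa ?ob ?a1 ?b1.
have pN e : ~~ odd (size e) -> head 0 e <= 0 -> all (fun c => c <= -1) (behead e)
    -> pos_cf (map -%R e).
  move=> e1 e2 e3; rewrite /pos_cf size_map e1 /=; apply/andP; split.
    by case: (e) e2 => //= h _; rewrite oppr_ge0.
  by rewrite behead_map all_map; apply: sub_all e3 => c /=; rewrite lerNr.
apply: (inj_map (@oppr_inj int)).
by apply: pos_cf_inj; rewrite ?pN // !cf_valN va vb.
Qed.

Section QMatrices.
Variables (F : fieldType).
Implicit Types (t : F) (a : seq int).

Definition mx2 (a b c d : F) : 'M[F]_2 :=
  \matrix_(i, j) if i == 0 then (if j == 0 then a else b)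
                 else (if j == 0 then c else d).

Definition cv2 (a b : F) : 'cV[F]_2 := \col_i if i == 0 then a else b.

Definition Rmx t := mx2 t 1 0 1.
Definition Lmx t := mx2 1 0 1 t^-1.

Fixpoint Mmx t a : 'M[F]_2 :=
  if a is [:: c, d & a'] then Rmx t ^ c * Lmx t ^ d * Mmx t a' else 1.

End QMatrices.

(* Z[q^{+-1}] is handled inside the field Q(q), realised as the fraction field
   of Z[q]. *)
Notation qfrac := {fraction {poly int}}.
Notation "p %:F" := (@FracField.tofrac _ p) : ring_scope.

Definition q : qfrac := 'X%:F.

(* Homogeneous coordinates of M_q(1/(1-q)) and of M_q(1/0). *)
Definition flat_vec (x : rat) : 'cV[qfrac]_2 :=
  Mmx q (even_cf x) *m cv2 1 (1 - q).
Definition sharp_vec (x : rat) : 'cV[qfrac]_2 :=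
  Mmx q (even_cf x) *m cv2 1 0.

(* The unit +- q^n of Z[q^{+-1}], coded by its sign bit and its exponent. *)
Definition qunit (c : bool * int) : qfrac := (-1) ^+ c.1 * q ^ c.2.

(* f^\vee = q^(deg f) f(q^-1), with deg f = (size f).-1; see recipE. *)
Definition recip (f : {poly int}) : {poly int} :=
  \poly_(i < size f) f`_((size f).-1 - i).

Section Evaluation.
Variables (F : fieldType) (t : F).
Hypothesis t0 : t != 0.
Implicit Types (f g : {poly int}).

Definition ev f : F := (map_poly intr f).[t].

Lemma evD f g : ev (f + g) = ev f + ev g.
Proof. by rewrite /ev rmorphD hornerD. Qed.
Lemma evM f g : ev (f * g) = ev f * ev g.
Proof. by rewrite /ev rmorphM hornerM. Qed.
Lemma evX : ev 'X = t.
Proof. by rewrite /ev map_polyX hornerX. Qed.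
Lemma ev1 : ev 1 = 1.
Proof. by rewrite /ev rmorph1 hornerC. Qed.
Lemma ev0 : ev 0 = 0.
Proof. by rewrite /ev rmorph0 hornerC. Qed.

End Evaluation.

Lemma ev_recip (F : fieldType) (t : F) f : t != 0 ->
  ev t (recip f) = t ^+ (size f).-1 * ev t^-1 f.
Proof.
move=> t0; rewrite /ev.
have sz1 : (size (map_poly intr (recip f) : {poly F}) <= size f)%N.
  by rewrite (leq_trans (size_poly _ _)) // size_poly.
rewrite (horner_coef_wide _ sz1) (horner_coef_wide _ (size_poly _ _)) mulr_sumr.
rewrite (reindex_inj rev_ord_inj) /=; apply: eq_bigr => i _.
rewrite !coef_map coef_poly /= ltn_subrL (leq_ltn_trans _ (ltn_ord i)) //=.
have -> : (size f - i.+1 = (size f).-1 - i)%N by rewrite subnS predn_sub.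
have hi : (i <= (size f).-1)%N by rewrite -ltnS (ltn_predK (ltn_ord i)).
rewrite subKn // mulrCA; congr (_ * _).
by rewrite -[in RHS](subnK hi) exprD exprVn mulfK // expf_neq0.
Qed.

Lemma tofrac_ev (f : {poly int}) : f%:F = ev q f.
Proof.
elim/poly_ind: f => [|f c IH]; first by rewrite tofrac0 ev0.
rewrite tofracD tofracM evD evM evX IH; congr (_ + _).
rewrite /ev map_polyC hornerC /=.
by rewrite -[c]intz !rmorph_int.
Qed.

Lemma q_neq0 : q != 0.
Proof. by rewrite tofrac_eq0 polyX_eq0. Qed.

Lemma recipE f : (recip f)%:F = q ^+ (size f).-1 * (map_poly intr f).[q^-1].
Proof.
by rewrite tofrac_ev ev_recip // q_neq0.
Qed.

Section Positive.
Variables (F : fieldType) (t : F).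
Hypothesis t0 : t != 0.

Lemma mul_mx2_cv2 (a b c d x y : F) :
  mx2 a b c d *m cv2 x y = cv2 (a * x + b * y) (c * x + d * y).
Proof.
apply/matrixP => i j; rewrite !mxE !big_ord_recl big_ord0 !mxE /= addr0.
by case: ifP.
Qed.

Lemma mul_mx2 (a b c d a' b' c' d' : F) :
  mx2 a b c d * mx2 a' b' c' d' =
  mx2 (a * a' + b * c') (a * b' + b * d') (c * a' + d * c') (c * b' + d * d').
Proof.
apply/matrixP => i j; rewrite !mxE !big_ord_recl big_ord0 !mxE /= addr0.
by case: ifP; case: ifP.
Qed.

Lemma mx2_1 : mx2 1 0 0 1 = 1 :> 'M[F]_2.
Proof. by apply/matrixP => -[[|[]] ?] // [[|[]] ?] //; rewrite !mxE. Qed.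

Lemma Rmx_unit : Rmx t \is a GRing.unit.
Proof.
apply/unitrP; exists (mx2 t^-1 (- t^-1) 0 1).
by rewrite /Rmx !mul_mx2; split; rewrite -mx2_1; congr mx2; field.
Qed.

Lemma Lmx_unit : Lmx t \is a GRing.unit.
Proof.
apply/unitrP; exists (mx2 1 0 (- t) t).
by rewrite /Lmx !mul_mx2; split; rewrite -mx2_1; congr mx2; field.
Qed.

(* The invariant of the vectors of a positive rational. *)
Definition good (w : 'cV[F]_2) := exists (n : int) (R S : {poly int}),
  [/\ R \is monic, S \is monic, S`_0 = 1, (size S <= size R)%N &
      w = cv2 (t ^ n * ev t R) (t ^ n * ev t S)].

Lemma good_R w : good w -> good (Rmx t *m w).
Proof.
move=> [n [R [S [Rm Sm S0 sz ->]]]]; exists n, ('X * R + S), S.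
have Rn0 := monic_neq0 Rm.
have sXR : size ('X * R) = (size R).+1 by rewrite mulrC size_mulX.
have lt : (size S < size ('X * R)%R)%N by rewrite sXR.
split=> //.
- by rewrite monicE lead_coefDl // mulrC lead_coefMX -monicE.
- by rewrite size_polyDl // sXR leqW.
- by rewrite mul_mx2_cv2 evD evM evX; congr cv2; ring.
Qed.

Lemma good_L w : good w -> good (Lmx t *m w).
Proof.
move=> [n [R [S [Rm Sm S0 sz ->]]]]; exists (n - 1), ('X * R), ('X * R + S).
have Rn0 := monic_neq0 Rm.
have sXR : size ('X * R) = (size R).+1 by rewrite mulrC size_mulX.
have lt : (size S < size ('X * R)%R)%N by rewrite sXR.
split=> //.
- by rewrite monicE mulrC lead_coefMX -monicE.
- by rewrite monicE lead_coefDl // mulrC lead_coefMX -monicE.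
- by rewrite coefD coefXM S0 add0r.
- by rewrite size_polyDl.
- rewrite mul_mx2_cv2 evD evM evX expfzDr // exprN1; congr cv2; field; exact: t0.
Qed.

Lemma good_Rn n w : good w -> good (Rmx t ^+ n *m w).
Proof.
move=> gw; elim: n => [|n IH]; first by rewrite expr0 mul1mx.
by rewrite exprS -mulmxA; apply: good_R.
Qed.

Lemma good_Ln n w : good w -> good (Lmx t ^+ n *m w).
Proof.
move=> gw; elim: n => [|n IH]; first by rewrite expr0 mul1mx.
by rewrite exprS -mulmxA; apply: good_L.
Qed.

Lemma good_pos a w : pos_cf a -> a != [::] -> good (Lmx t *m w) ->
  good (Mmx t a *m w).
Proof.
move=> + + gw; have [n] := ubnP (size a); elim: n a => // n IH.
case=> [|c [|d a]] // an; rewrite pos_cf_cons2 => /and4P[c0 d1 a1 a2] _ /=.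
case: c an c0 => // c an _; case: d an d1 => // -[|d] // an _.
rewrite -!exprnP -!mulmxA; apply: good_Rn.
have [->|aN] := eqVneq a [::].
  by rewrite /= mul1mx exprSr -mulmxA; apply: good_Ln.
apply/good_Ln/IH => //; first by move: an => /=; lia.
rewrite /pos_cf a2 /=; case: (a) a1 => //= x e /andP[x1 ->].
by rewrite andbT (le_trans ler01).
Qed.

Lemma good_flat a : pos_cf a -> a != [::] -> good (Mmx t a *m cv2 1 (1 - t)).
Proof.
move=> pa aN; apply: good_pos pa aN _.
exists (-1), 'X, 1; split; rewrite ?monicX ?monic1 ?size_polyX ?size_poly1 //.
  by rewrite coefC.
by rewrite mul_mx2_cv2 evX ev1 exprN1; congr cv2; field.
Qed.

Lemma good_sharp a : pos_cf a -> a != [::] -> good (Mmx t a *m cv2 1 0).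
Proof.
move=> pa aN; apply: good_pos pa aN _.
exists 0, 1, 1; split; rewrite ?monic1 // ?coefC //.
by rewrite mul_mx2_cv2 ev1 expr0z; congr cv2; ring.
Qed.

End Positive.

Section Negative.
Variables (F : fieldType) (t : F).
Hypothesis t0 : t != 0.

Let D := mx2 t 0 0 (-1).

Lemma D_unit : D \is a GRing.unit.
Proof.
apply/unitrP; exists (mx2 t^-1 0 0 (-1)).
by rewrite /D !mul_mx2; split; rewrite -mx2_1; congr mx2; field.
Qed.

Lemma D_conj (A B : 'M[F]_2) (n : nat) : A \is a GRing.unit ->
  D = B * D * A -> D * A ^ (- n%:Z) = B ^ n * D.
Proof.
move=> uA e.
have e' : D * A^-1 = B * D by rewrite [in LHS]e mulrK.
rewrite -exprnN -exprVn -exprnP; elim: n => [|n IH].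
  by rewrite !expr0 mulr1 mul1r.
by rewrite exprSr mulrA IH -mulrA e' mulrA -exprSr.
Qed.

Lemma D_Mmx a : all (fun c : int => 0 <= c) a -> ~~ odd (size a) ->
  D * Mmx t (map -%R a) = Mmx t^-1 a * D.
Proof.
have [n] := ubnP (size a); elim: n a => // n IH.
case=> [|c [|d a]] // an; first by rewrite /= mulr1 mul1r.
case: c an => // c an; case: d an => // d an /= a1; rewrite negbK => a2.
have eR : D = Rmx t^-1 * D * Rmx t.
  by rewrite /D /Rmx !mul_mx2; congr mx2; field.
have eL : D = Lmx t^-1 * D * Lmx t.
  by rewrite /D /Lmx invrK !mul_mx2; congr mx2; field.
rewrite !mulrA (D_conj _ (Rmx_unit t0) eR) -(mulrA _ D).
rewrite (D_conj _ (Lmx_unit t0) eL) -!mulrA IH //.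
by move: an => /=; lia.
Qed.

Lemma D_cv2 x y : D *m cv2 x y = cv2 (t * x) (- y).
Proof. by rewrite mul_mx2_cv2; congr cv2; ring. Qed.

Lemma good_neg a v v' : all (fun c : int => 0 <= c) a -> ~~ odd (size a) ->
    D *m v = t *: v' -> good t^-1 (Mmx t^-1 a *m v') ->
  exists (n k : int) (R S : {poly int}), S`_0 = 1 /\
    Mmx t (map -%R a) *m v = cv2 (t ^ k * ev t R) (- (t ^ n * ev t S)).
Proof.
move=> a1 a2 vv' [n [R [S [Rm Sm S0 sz e]]]].
exists (1 - n - (size S).-1%:Z), (- n - (size R).-1%:Z), (recip R), (recip S).
have Sn0 : (0 < size S)%N by rewrite size_poly_gt0 monic_neq0.
split; first by rewrite coef_poly Sn0 subn0 -lead_coefE (monicP Sm).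
have K (k : nat) y : t ^ (- k%:Z) * (t ^+ k * y) = y.
  by rewrite -exprnN mulKf ?expf_neq0.
rewrite !ev_recip // !expfzDr // -!mulrA !K expr1z.
have De : D *m (Mmx t (map -%R a) *m v) =
    cv2 (t * (t ^ (- n) * ev t^-1 R)) (t * (t ^ (- n) * ev t^-1 S)).
  rewrite mulmxA -[D *m _]/(D * _) D_Mmx // -mulmxA vv' -scalemxAr e exprz_inv.
  by apply/matrixP => i j; rewrite !mxE; case: ifP.
apply: (can_inj (mulKmx D_unit)); rewrite De D_cv2; congr cv2.
by rewrite opprK.
Qed.

Lemma D_flat : D *m cv2 1 (1 - t) = t *: cv2 1 (1 - t^-1).
Proof.
rewrite D_cv2; apply/matrixP => i j; rewrite !mxE.
by case: ifP => _; field.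
Qed.

Lemma D_sharp : D *m cv2 1 0 = t *: cv2 1 0.
Proof.
by rewrite D_cv2; apply/matrixP => i j; rewrite !mxE; case: ifP => _; ring.
Qed.

Lemma Mmx_zero (x y : F) :
  Mmx t [:: -1; 1] *m cv2 x y =
  cv2 (- (t^-1 * t^-1 * y)) (x + t^-1 * y).
Proof.
rewrite [Mmx _ _]/= mulr1 expr1z -mulmxA mul_mx2_cv2.
apply: (can_inj (mulKmx (Rmx_unit t0))).
rewrite mulmxA -[Rmx t *m _]/(Rmx t * _) exprN1 divrr ?Rmx_unit //.
rewrite mul1mx mul_mx2_cv2.
by congr cv2; field.
Qed.

Lemma Mmx_flat0 : Mmx t [:: -1; 1] *m cv2 1 (1 - t) =
  cv2 (t ^ (-2) * ev t ('X + (-1)%:P)) (t ^ (-1) * ev t 1).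
Proof.
rewrite Mmx_zero ev1 evD evX exprN1 -exprnN.
rewrite [ev t (-1)%:P]/ev map_polyC hornerC /= rmorphN1.
by congr cv2; field.
Qed.

Lemma Mmx_sharp0 : Mmx t [:: -1; 1] *m cv2 1 0 = cv2 0 1.
Proof. by rewrite Mmx_zero; congr cv2; ring. Qed.

End Negative.

(* Scaling v by the unit cS.1 turns its lower entry into the polynomial cS.2,
   whose constant term is 1. *)
Definition normalizes (v : 'cV[qfrac]_2) (cS : (bool * int) * {poly int}) :=
  (cS.2`_0 == 1) && (cS.2%:F == qunit cS.1 * v 1 0).

Lemma qunit_neq0 c : qunit c != 0.
Proof. by rewrite /qunit mulf_neq0 ?signr_eq0 ?expfz_neq0 ?q_neq0. Qed.

Lemma qunit_pos (n : nat) (S S' : {poly int}) (b b' : bool) :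
  S`_0 = 1 -> S'`_0 = 1 ->
  (-1) ^+ b * q ^+ n * S%:F = (-1) ^+ b' * S'%:F -> [/\ n = 0, b = b' & S = S'].
Proof.
move=> s s' e.
have {}e : (-1) ^+ b * 'X^n * S = (-1) ^+ b' * S'.
  have sF (c : bool) : ((-1) ^+ c)%:F = (-1) ^+ c by exact: rmorph_sign.
  by apply/eqP; rewrite -tofrac_eq !tofracM (tofracXn n) !sF e.
have := congr1 (fun p : {poly int} => p`_0) e.
have sg (c : bool) (p : {poly int}) : ((-1) ^+ c * p)`_0 = (-1) ^+ c * p`_0.
  by case: c; rewrite ?expr1 ?mulN1r ?coefN // expr0 !mul1r.
rewrite -mulrA !sg coefXnM s'.
case: n e => [|n] e /=; last by case: b' {e}; rewrite mulr0.
rewrite s !mulr1 => /signr_inj bb; split=> //.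
by move: e; rewrite bb expr0 mulr1; apply: (mulrI (unitrX _ (unitrN1 _))).
Qed.

Lemma normalizes_unique v c S c' S' :
  normalizes v (c, S) -> normalizes v (c', S') -> c = c' /\ S = S'.
Proof.
wlog le : c S c' S' / c'.2 <= c.2.
  move=> W h h'; case: (leP c'.2 c.2) => [|/ltW] le; first exact: W.
  by have [-> ->] := W _ _ _ _ le h' h.
case: c c' le => b n [b' n'] /= le.
move=> /andP[/eqP s /eqP e] /andP[/eqP s' /eqP e']; rewrite /= /qunit /= in s s' e e'.
have e1 : (-1) ^+ b' * q ^+ `|n - n'|%N * S'%:F = (-1) ^+ b * S%:F.
  have nn : q ^ n = q ^ (n' ) * q ^+ `|n - n'|%N.
    by rewrite exprnP -expfzDr ?q_neq0 // gez0_abs ?subr_ge0 // [n' + _]addrC subrK.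
  rewrite e e' nn; move: (q ^ n') (q ^+ _) (v 1 0) => A B C.
  by case: (b); case: (b'); rewrite ?expr1 ?expr0; ring.
have [/eqP + -> ->] := qunit_pos s' s e1.
by rewrite absz_eq0 subr_eq0 => /eqP ->.
Qed.

Lemma even_cf_pos x : 0 < x -> pos_cf (even_cf x) /\ even_cf x != [::].
Proof.
move=> x0; have /and3P[oa /eqP va] := even_cfP x.
rewrite gt_eqF // x0 => /andP[a1 a2]; rewrite /pos_cf oa a1 a2; split=> //.
by apply/eqP => e; move: x0; rewrite -va e ltxx.
Qed.

Lemma even_cf_neg x : x < 0 ->
  exists2 a, even_cf x = map -%R a & pos_cf a /\ a != [::].
Proof.
move=> x0; have /and3P[oa /eqP va] := even_cfP x.
rewrite lt_eqF // ltNge ltW //= => /andP[a1 a2].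
exists (map -%R (even_cf x)).
  by rewrite -map_comp map_id_in // => c _ /=; rewrite opprK.
rewrite /pos_cf size_map oa behead_map all_map /=; split; last first.
  apply/eqP => e; move: x0; rewrite -va.
  by case: (even_cf x) e => //; rewrite ltxx.
apply/andP; split; last by apply: sub_all a2 => c /=; rewrite lerNr.
by case: (even_cf x) a1 => //= h _; rewrite oppr_ge0.
Qed.

Lemma even_cf0 : even_cf 0 = [:: -1; 1].
Proof. by have /and3P[_ _ /eqP] := even_cfP 0. Qed.

Definition tame (v : 'cV[qfrac]_2) :=
  exists (e : bool) (n k : int) (R S : {poly int}), S`_0 = 1 /\
    v = cv2 (q ^ k * ev q R) ((-1) ^+ e * (q ^ n * ev q S)).

Lemma pos_cf_ge0 a : pos_cf a -> all (fun c : int => 0 <= c) a.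
Proof.
case/and3P => _; case: a => //= c a -> h /=.
by apply: sub_all h => d /=; apply: le_trans.
Qed.

Lemma flat_tame x : tame (flat_vec x).
Proof.
rewrite /flat_vec; have [x0|x0|->] := ltrgt0P x.
- have [pa aN] := even_cf_pos x0.
  have [n [R [S [_ _ S0 _ ->]]]] := good_flat q_neq0 pa aN.
  by exists false, n, n, R, S; rewrite expr0 mul1r.
- have [a -> [pa aN]] := even_cf_neg x0.
  have q'0 : q^-1 != 0 by rewrite invr_eq0 q_neq0.
  have oa : ~~ odd (size a) by case/and3P: pa.
  have [n [k [R [S [S0 ->]]]]] :=
    good_neg q_neq0 (pos_cf_ge0 pa) oa (D_flat q_neq0) (good_flat q'0 pa aN).
  by exists true, n, k, R, S; rewrite expr1 mulN1r.
- rewrite even_cf0 (Mmx_flat0 q_neq0).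
  exists false, (-1), (-2), ('X + (-1)%:P), 1; split; first by rewrite coefC.
  by rewrite expr0 mul1r.
Qed.

Lemma sharp_tame x : tame (sharp_vec x).
Proof.
rewrite /sharp_vec; have [x0|x0|->] := ltrgt0P x.
- have [pa aN] := even_cf_pos x0.
  have [n [R [S [_ _ S0 _ ->]]]] := good_sharp q_neq0 pa aN.
  by exists false, n, n, R, S; rewrite expr0 mul1r.
- have [a -> [pa aN]] := even_cf_neg x0.
  have q'0 : q^-1 != 0 by rewrite invr_eq0 q_neq0.
  have oa : ~~ odd (size a) by case/and3P: pa.
  have [n [k [R [S [S0 ->]]]]] :=
    good_neg q_neq0 (pos_cf_ge0 pa) oa (D_sharp q) (good_sharp q'0 pa aN).
  by exists true, n, k, R, S; rewrite expr1 mulN1r.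
- rewrite even_cf0 (Mmx_sharp0 q_neq0).
  exists false, 0, 0, 0, 1; split; first by rewrite coefC.
  by rewrite expr0 ev0 ev1 expr0z mulr0 !mulr1.
Qed.

Lemma tame_normalizes v : tame v -> exists cS, normalizes v cS.
Proof.
move=> [e [n [k [R [S [S0 ->]]]]]]; exists ((e, - n), S).
rewrite /normalizes S0 eqxx /= tofrac_ev /qunit /= !mxE /=.
have K y : q ^ (- n) * (q ^ n * y) = y.
  by rewrite mulrA -expfzDr ?q_neq0 // addNr mul1r.
have sg y : (-1) ^+ e * ((-1) ^+ e * y) = y by rewrite mulrA -expr2 sqrr_sign mul1r.
by rewrite -mulrA [q ^ (- n) * _]mulrCA K sg.
Qed.

(* Uniquely determined by normalizes; see normalizes_unique. *)
Definition flat_norm (x : rat) := xchoose (tame_normalizes (flat_tame x)).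
Definition sharp_norm (x : rat) := xchoose (tame_normalizes (sharp_tame x)).

Definition Rflat (x : rat) : qfrac := qunit (flat_norm x).1 * flat_vec x 0 0.
Definition Sflat (x : rat) : {poly int} := (flat_norm x).2.
Definition Rsharp (x : rat) : qfrac := qunit (sharp_norm x).1 * sharp_vec x 0 0.
Definition Ssharp (x : rat) : {poly int} := (sharp_norm x).2.

Lemma flat_normP x : normalizes (flat_vec x) (flat_norm x).
Proof. exact: (xchooseP (tame_normalizes (flat_tame x))). Qed.

Lemma sharp_normP x : normalizes (sharp_vec x) (sharp_norm x).
Proof. exact: (xchooseP (tame_normalizes (sharp_tame x))). Qed.

Definition laurent (f : qfrac) :=
  exists (n : int) (p : {poly int}), f = q ^ n * p%:F.

Lemma tame_laurent v c : tame v -> laurent (qunit c * v 0 0).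
Proof.
move=> [e [n [k [R [S [_ ->]]]]]]; exists (c.2 + k), ((-1) ^+ c.1 * R).
rewrite !mxE /= tofracM -tofrac_ev expfzDr ?q_neq0 // /qunit.
have -> : ((-1) ^+ c.1)%:F = (-1) ^+ c.1 :> qfrac by exact: rmorph_sign.
by rewrite mulrA mulrCA -!mulrA mulrCA.
Qed.

Lemma Rflat_laurent x : laurent (Rflat x).
Proof. exact/tame_laurent/flat_tame. Qed.

Lemma Rsharp_laurent x : laurent (Rsharp x).
Proof. exact/tame_laurent/sharp_tame. Qed.

Lemma norm_jones_exists (x : rat) : exists J : {poly int},
  (1 < x) ==> (J%:F == q * Rsharp x + (1 - q) * (Ssharp x)%:F).
Proof.
have [x1|] := boolP (1 < x); last by exists 0.
have [pa aN] := even_cf_pos (lt_trans ltr01 x1).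
have [n [R [S [_ _ S0 _ e]]]] := good_sharp q_neq0 pa aN.
have nS : normalizes (sharp_vec x) ((false, - n), S).
  rewrite /normalizes S0 eqxx /= /qunit /sharp_vec e !mxE /= expr0 mul1r.
  by rewrite mulrA -expfzDr ?q_neq0 // addNr mul1r tofrac_ev.
have := sharp_normP x; rewrite [sharp_norm x]surjective_pairing => nS'.
have [ec eS] := normalizes_unique nS' nS.
exists ('X * R + (1 - 'X) * S); apply/eqP.
rewrite /Rsharp /Ssharp ec eS /qunit /sharp_vec e !mxE /= expr0 mul1r.
rewrite mulrA mulrA -(mulrA q) -expfzDr ?q_neq0 // addNr mulr1.
by rewrite tofracD !tofracM tofracB tofrac1 -tofrac_ev.
Qed.

(* The normalised Jones polynomial of the 2-bridge link L(x), x > 1, given by the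
   formula of Morier-Genoud and Ovsienko: q R^# + (1 - q) S^#, which lies in Z[q]
   for these x. The value for x <= 1 is irrelevant. *)
Definition norm_jones (x : rat) : {poly int} := xchoose (norm_jones_exists x).

Lemma norm_jonesE (x : rat) : 1 < x ->
  (norm_jones x)%:F = q * Rsharp x + (1 - q) * (Ssharp x)%:F.
Proof. by move=> x1; have /implyP/(_ x1)/eqP := xchooseP (norm_jones_exists x). Qed.

Definition qequiv (f g : qfrac) := exists c : bool * int, f = qunit c * g.

Definition palindromic (f : {poly int}) := f == recip f.

(* Main.v *)
Require Import Defs.
From mathcomp Require Import all_boot all_order all_algebra.
From mathcomp Require Import zify ring lra.
Import Order.TTheory GRing.Theory Num.Theory.
Local Open Scope ring_scope.
Set Implicit Arguments.
Unset Strict Implicit.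

(**
The three statements reduce to one polynomial attached to a word in two
letters.  Write R for R_q and L for q L_q, so that words in R and L have
matrices with polynomial entries; a continued fraction of a positive rational
spells such a word, and q L_q sends the flat vector (1, 1 - q) to (q, 1).  For
a word u with matrix W, put P_u = (q, 1) W (q, 1)^T ([wform], [wpoly]).  Since
R fixes the lower row and L only multiplies the upper row by q, stripping
initial letters shows that the numerator and the denominator of a flat
q-rational are each, up to a unit, either 1 or some P_u.  For negative
rationals q is replaced by 1/q, which only replaces P_u by its reciprocal
polynomial, and 0 is a direct computation.

The key fact is that P_u is palindromic if and only if the integer matrix
W(1) = (a b; c d) is symmetric ([palindromic_wpoly]).

If b = c, the word is its own mirror image under reading backwards and
exchanging the letters, because this operation transposes W(1)
([word_mirror]) and because R and L generate a free monoid already at q = 1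
([word1_inj]).  And the polynomial of the mirror word is always the
reciprocal of P_u ([recip_wpoly]): conjugation by a fixed matrix turns q into
1/q in every letter ([bar_word]).

Conversely, a palindromic f satisfies 2 f'(1) = (deg f) f(1), whereas for P_u
the difference of the two sides is exactly c - b ([deriv_wpoly]).  The reason
is that differentiation at q = 1 acts on the two letters as the same inner
derivation plus half the identity ([deriv_word]).

It remains to read the symmetry of W(1) arithmetically.  With m = P_u(1) =
a + b + c + d one has (a + b)^2 + 1 = (a + b)(b - c) + a m, where a + b is
prime to m and |b - c| < m; so m divides (a + b)^2 + 1 exactly when b = c
([dvd_wform_sym]).  If P_u is the denominator of the flat deformation of r/s
then m = s and a + b = r mod s; if it is the numerator, m = r and
a + b = - s mod r.

Finally, for r/s > 1 the normalized Jones polynomial is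
(q^2, 1) W (1, 1)^T, where P_u is the flat numerator, and this is the
polynomial of the mirror word ([wform_mirror]), that is, the reciprocal of P_u.
*)

(** * Words in two letters and their matrices *)

Section Words.
Variable R : comNzRingType.
Implicit Types (t : R) (b : bool) (u v : seq bool) (i j : 'I_2).

(** Counterpart of [mx2] over a ring that need not be a field, so that the entries
    can be polynomials in q. *)
Definition mat2 (a b c d : R) : 'M[R]_2 :=
  \matrix_(i, j) if i == 0 then (if j == 0 then a else b)
                 else (if j == 0 then c else d).

(** [true] stands for the matrix R_t and [false] for t L_t; the factor t clears
    the denominator of L_t and changes vectors only by a unit. *)
Definition letter t b : 'M[R]_2 :=
  if b then mat2 t 1 0 1 else mat2 t 0 t 1.

Fixpoint word t u : 'M[R]_2 :=
  if u is b :: u' then letter t b *m word t u' else 1%:M.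

Lemma ord2P (Q : 'I_2 -> Prop) : Q 0 -> Q 1 -> forall i, Q i.
Proof.
move=> Q0 Q1 [[|[|//]] hi].
  by rewrite (_ : Ordinal hi = 0) //; apply: val_inj.
by rewrite (_ : Ordinal hi = 1) //; apply: val_inj.
Qed.

Lemma mulmx2E n (A : 'M[R]_2) (B : 'M[R]_(2, n)) i (k : 'I_n) :
  (A *m B) i k = A i 0 * B 0 k + A i 1 * B 1 k.
Proof.
rewrite mxE !big_ord_recl big_ord0 addr0.
by rewrite (_ : lift ord0 ord0 = 1) //; apply: val_inj.
Qed.

Lemma matrix2P (A B : 'M[R]_2) :
  A 0 0 = B 0 0 -> A 0 1 = B 0 1 -> A 1 0 = B 1 0 -> A 1 1 = B 1 1 -> A = B.
Proof. by move=> *; apply/matrixP; apply: ord2P; apply: ord2P. Qed.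

Lemma word_cons t b u i j : word t (b :: u) i j =
  if b then (if i == 0 then t * word t u 0 j + word t u 1 j else word t u 1 j)
  else (if i == 0 then t * word t u 0 j else t * word t u 0 j + word t u 1 j).
Proof.
by case: b; move: i; apply: ord2P; rewrite [word _ _]/= mulmx2E !mxE /=; ring.
Qed.

Lemma word_cat t u v : word t (u ++ v) = word t u *m word t v.
Proof. by elim: u => [|b u IH] /=; rewrite ?mul1mx // IH mulmxA. Qed.

Lemma word_rcons t b u i j : word t (rcons u b) i j =
  if b then (if j == 0 then t * word t u i 0 else word t u i 0 + word t u i 1)
  else (if j == 0 then t * (word t u i 0 + word t u i 1) else word t u i 1).
Proof.
rewrite -cats1 word_cat mulmx2E !word_cons !mxE.
by case: b; move: j; apply: ord2P => /=; ring.
Qed.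

(** On the integer matrices obtained at t = 1 this is transposition. *)
Definition mirror u := rev (map negb u).

(** With K = diag(t, 1), the transpose of each letter is the K-conjugate of the
    other letter, so the transpose of the matrix of u is the K-conjugate of the
    matrix of its mirror image. *)
Lemma word_mirror t u :
  [/\ word t (mirror u) 0 0 = word t u 0 0,
      t * word t (mirror u) 0 1 = word t u 1 0,
      word t (mirror u) 1 0 = t * word t u 0 1
    & word t (mirror u) 1 1 = word t u 1 1].
Proof.
elim: u => [|b u [e1 e2 e3 e4]]; first by rewrite /= !mxE /= !mulr0.
rewrite /mirror /= rev_cons -/(mirror u) !word_rcons !word_cons.
by case: b => /=; split; rewrite ?mulrDr ?e1 ?e2 ?e3 ?e4 //; ring.
Qed.

(** The value (t, 1) W (t, 1)^T.  Here (t, 1)^T is the image of the flat vector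
    (1, 1 - t)^T under t L_t, and (t, 1) is the lower row of the letter L as
    well as the upper row of the letter R. *)
Definition wform t u :=
  t ^+ 2 * word t u 0 0 + t * (word t u 0 1 + word t u 1 0) + word t u 1 1.

(** The right-hand side is (t^2, 1) W (1, 1)^T, the shape in which the Jones
    polynomial appears. *)
Lemma wform_mirror t u : wform t (mirror u) =
  t ^+ 2 * (word t u 0 0 + word t u 0 1) + (word t u 1 0 + word t u 1 1).
Proof.
have [e1 e2 e3 e4] := word_mirror t u.
by rewrite /wform e1 e3 e4 mulrDr e2; ring.
Qed.

Lemma word_at0 u : word 0 u 1 0 = 0 /\ word 0 u 1 1 = 1.
Proof.
elim: u => [|b u [IH0 IH1]]; first by rewrite !mxE.
by rewrite !word_cons IH0 IH1; case: b => /=; split; ring.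
Qed.

End Words.

Lemma word_morph (R S : comNzRingType) (f : {rmorphism R -> S}) t u i j :
  f (word t u i j) = word (f t) u i j.
Proof.
elim: u i j => [|b u IH] i j; first by rewrite !mxE rmorph_nat.
rewrite !word_cons -!IH; case: b; case: ifP => _ //.
all: by rewrite ?rmorphD rmorphM.
Qed.

Lemma wform_morph (R S : comNzRingType) (f : {rmorphism R -> S}) t u :
  f (wform t u) = wform (f t) u.
Proof. by rewrite /wform !(rmorphD, rmorphM, rmorphXn) /= !word_morph. Qed.

(** * Inverting the parameter *)

(** One fixed matrix intertwines every letter at t with t times the same letter
    at 1/t, and therefore does so for all words. *)
Lemma bar_word (F : fieldType) (t : F) u : t != 0 ->
  mat2 t (1 - t) (t - 1) 1 *m word t u =
  t ^+ size u *: (word t^-1 u *m mat2 t (1 - t) (t - 1) 1).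
Proof.
move=> t0; set B := mat2 _ _ _ _.
have comm b : B *m letter t b = t *: (letter t^-1 b *m B).
  by case: b; apply: matrix2P; rewrite [RHS]mxE !mulmx2E !mxE /=; field.
elim: u => [|b u IH] /=; first by rewrite mulmx1 mul1mx scale1r.
by rewrite mulmxA comm -scalemxAl -mulmxA IH -scalemxAr scalerA mulmxA exprS.
Qed.

(** The intertwiner B of [bar_word] sends (1, 1)^T to (1, t)^T, and (1, t) B =
    (t^2, 1).  Sandwiching [bar_word] between (1, t) and (1, 1)^T thus compares
    (t^2, 1) W(t) (1, 1)^T with (1, t) W(1/t) (1, t)^T. *)
Lemma wform_inv (F : fieldType) (t : F) u : t != 0 ->
  wform t (mirror u) = t ^+ (size u).+2 * wform t^-1 u.
Proof.
move=> t0; rewrite wform_mirror.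
have E i j : _ i j = _ := congr1 (fun A : 'M_2 => A i j) (bar_word u t0).
move: (E 0 0) (E 0 1) (E 1 0) (E 1 1).
have S (x : F) (A : 'M[F]_2) i j : (x *: A) i j = x * A i j by rewrite mxE.
rewrite {E} !S !mulmx2E !mxE /=.
rewrite /wform !exprS; set m := t ^+ _.
move: (word t u 0 0) (word t u 0 1) (word t u 1 0) (word t u 1 1) => a b c d.
move: (word t^-1 u 0 0) (word t^-1 u 0 1) => a' b'.
move: (word t^-1 u 1 0) (word t^-1 u 1 1) => c' d'.
move=> e1 e2 e3 e4.
(* The middle term is (1, t) B W (1, 1)^T. *)
transitivity (t * a + (1 - t) * c + (t * b + (1 - t) * d) +
  t * ((t - 1) * a + 1 * c + ((t - 1) * b + 1 * d))); first by ring.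
by rewrite e1 e2 e3 e4; field.
Qed.

(** * The polynomial of a word *)

Local Notation pword := (word ('X : {poly int})).

Definition wpoly u : {poly int} := wform 'X u.

Lemma ev_word (F : fieldType) (t : F) u i j : ev t (pword u i j) = word t u i j.
Proof.
have := word_morph
  (horner_eval t \o map_poly intr : {rmorphism {poly int} -> F}) 'X u i j.
by rewrite /= map_polyX /horner_eval hornerX => <-.
Qed.

Lemma ev_wpoly (F : fieldType) (t : F) u : ev t (wpoly u) = wform t u.
Proof.
have := wform_morph
  (horner_eval t \o map_poly intr : {rmorphism {poly int} -> F}) 'X u.
by rewrite /= map_polyX /horner_eval hornerX => <-.
Qed.

Lemma horner_word (x : int) u i j : (pword u i j).[x] = word x u i j.
Proof. by rewrite -horner_evalE word_morph /= /horner_eval hornerX. Qed.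

Lemma horner_wpoly (x : int) u : (wpoly u).[x] = wform x u.
Proof. by rewrite -horner_evalE wform_morph /= /horner_eval hornerX. Qed.

Lemma wpoly_coef0 u : (wpoly u)`_0 = 1.
Proof.
rewrite -horner_coef0 horner_wpoly /wform.
by have [_ ->] := word_at0 int u; rewrite expr0n !mul0r !add0r.
Qed.

Lemma size_word u :
  [/\ pword u 0 0 \is monic, size (pword u 0 0) = (size u).+1
    & forall i j, (size (pword u i j) <= (size u).+1)%N].
Proof.
elim: u => [|b u [m s IH]].
  rewrite !mxE /= monic1 size_poly1; split=> // i j.
  by rewrite mxE; case: (_ == _); rewrite ?size_poly1 ?size_poly0.
have szX (p : {poly int}) :
    (size p <= (size u).+1)%N -> (size ('X * p)%R <= (size u).+2)%N.
  by move=> h; rewrite (leq_trans (size_polyMleq _ _)) // size_polyX.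
have n0 := monic_neq0 m.
have sX : size ('X * pword u 0 0) = (size u).+2.
  by rewrite mulrC size_mulX // s.
have mX : 'X * pword u 0 0 \is @monic int by rewrite monicMr ?monicX.
have [mb sb] : pword (b :: u) 0 0 \is monic /\
    size (pword (b :: u) 0 0) = (size u).+2.
  rewrite word_cons; case: b => //=.
  have lt : (size (pword u 1%R 0%R) < size ('X * pword u 0 0)%R)%N.
    by rewrite sX ltnS IH.
  by rewrite size_polyDl // monicE lead_coefDl // -monicE.
split=> // i j; rewrite word_cons.
have D (p r : {poly int}) :
    (size p <= (size u).+1)%N -> (size r <= (size u).+1)%N ->
    (size ('X * p + r)%R <= (size u).+2)%N.
  move=> hp hr; rewrite (leq_trans (size_polyD _ _)) // geq_max szX //=.
  exact: leqW.
by case: b {mb sb}; case: ifP => _; rewrite ?D ?szX ?IH // leqW ?IH.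
Qed.

Lemma size_wpoly u : size (wpoly u) = (size u).+3.
Proof.
have [m s h] := size_word u.
rewrite /wpoly /wform -addrA size_polyDl; first last.
all: rewrite (mulrC ('X ^+ 2)) size_mulXn ?monic_neq0 // s // ltnS.
rewrite (leq_trans (size_polyD _ _)) // geq_max (leq_trans (h _ _)) ?andbT //.
rewrite (leq_trans (size_polyMleq _ _)) // size_polyX /= ltnS.
by rewrite (leq_trans (size_polyD _ _)) // geq_max !h.
Qed.

Lemma recip_wpoly u : recip (wpoly u) = wpoly (mirror u).
Proof.
apply/eqP; rewrite -tofrac_eq !tofrac_ev ev_recip ?q_neq0 // !ev_wpoly size_wpoly.
by rewrite wform_inv ?q_neq0.
Qed.

Lemma wpoly_monic u : wpoly u \is monic.
Proof.
have := wpoly_coef0 (mirror u); rewrite -recip_wpoly coef_poly subn0.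
by rewrite size_wpoly /= monicE lead_coefE size_wpoly => ->.
Qed.

(** * Freeness of the monoid at q = 1 *)

Lemma word1_ge0 u i j : 0 <= word (1 : int) u i j.
Proof.
elim: u i j => [|b u IH] i j; first by rewrite mxE; case: (_ == _).
by rewrite word_cons !mul1r; case: b; case: ifP => _ //; rewrite addr_ge0.
Qed.

Lemma word1_det u :
  word (1 : int) u 0 0 * word 1 u 1 1 - word 1 u 0 1 * word 1 u 1 0 = 1.
Proof.
elim: u => [|b u IH]; first by rewrite !mxE.
by rewrite -[RHS]IH !word_cons; case: b => /=; ring.
Qed.

Lemma word1_pos u :
  [/\ 0 < word (1 : int) u 0 0, 0 <= word (1 : int) u 0 1,
      0 <= word (1 : int) u 1 0 & 0 < word (1 : int) u 1 1].
Proof.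
have h := word1_ge0 u; rewrite !lt0r !h !andbT.
have bc : 0 <= word (1 : int) u 0 1 * word 1 u 1 0 by rewrite mulr_ge0.
suff : word (1 : int) u 0 0 * word 1 u 1 1 != 0.
  by rewrite mulf_eq0 negb_or => /andP[].
apply/eqP => ad0; move: (word1_det u) bc; rewrite ad0 sub0r => /eqP.
by rewrite eqr_oppLR => /eqP ->.
Qed.

Local Ltac generalize_entries u :=
  move: (word (1 : int) u 0 0 : int) (word (1 : int) u 0 1 : int)
        (word (1 : int) u 1 0 : int) (word (1 : int) u 1 1 : int) => ? ? ? ?.

(** The first letter can be read off: after R the upper row dominates the lower
    one, after L the lower row dominates the upper one. *)
Lemma word1_inj u v : word (1 : int) u = word 1 v -> u = v.
Proof.
elim: u v => [|b u IH] [|b' v] // e.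
all: have e' i j : word (1 : int) _ i j = word 1 _ i j :> int :=
  congr1 (fun A : 'M_2 => A i j) e.
all: have := e' 1 1; have := e' 1 0; have := e' 0 1; have := e' 0 0; clear e e'.
- rewrite !word_cons !mxE; have [] := word1_pos v.
  by case: b' => /=; rewrite !mul1r; generalize_entries v; lia.
- rewrite !word_cons !mxE; have [] := word1_pos u.
  by case: b => /=; rewrite !mul1r; generalize_entries u; lia.
rewrite !word_cons; have [] := word1_pos u; have [] := word1_pos v.
case: b; case: b' => /=; rewrite !mul1r; first 1 last.
1,2: by generalize_entries u; generalize_entries v; lia.
all: move=> _ _ _ _ _ _ _ _ e1 e2 e3 e4; congr cons; apply: IH.
all: apply: matrix2P; move: e1 e2 e3 e4.
all: by generalize_entries u; generalize_entries v; lia.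
Qed.

Lemma mirror_fixed u :
  word (1 : int) u 0 1 = word 1 u 1 0 -> mirror u = u.
Proof.
have [e1 e2 e3 e4] := word_mirror (1 : int) u; rewrite !mul1r in e2 e3.
by move=> e; apply: word1_inj; apply: matrix2P; rewrite // ?e2 ?e3 e.
Qed.

(** * The derivative at q = 1 *)

(** The coefficients weighted by i and by deg f - i have the same sum. *)
Lemma palindromic_deriv (f : {poly int}) : palindromic f ->
  2 * f^`().[1] = (size f).-1%:R * f.[1].
Proof.
move/eqP=> fr.
have fE k : (k < size f)%N -> f`_k = f`_((size f).-1 - k).
  by move=> kf; rewrite {1}fr coef_poly kf.
have d1 : f^`().[1] = \sum_(i < size f) f`_i *+ i.
  rewrite -{1}[f]coefK poly_def linear_sum horner_sum; apply: eq_bigr => i _.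
  by rewrite /= derivZ derivXn hornerZ hornerMn hornerXn expr1n mulr_natr.
have d2 : f^`().[1] = \sum_(i < size f) f`_i *+ ((size f).-1 - i).
  rewrite d1 (reindex_inj rev_ord_inj) /=; apply: eq_bigr => i _.
  have -> : (size f - i.+1 = (size f).-1 - i)%N by lia.
  by rewrite -fE.
rewrite [2]mulr2n mulrDl mul1r {1}d1 d2 -big_split /= horner_coef mulr_sumr.
apply: eq_bigr => i _; rewrite -mulrnDr expr1n mulr1 mulr_natl; congr (_ *+ _).
by have := ltn_ord i; lia.
Qed.

(** With Y = (0 1; -1 1), both letters satisfy 2 W' = Y W - W Y + W at q = 1.
    The commutator with Y is a derivation, so 2 W' = Y W - W Y + n W for a word
    of length n; these are the four entries of that identity. *)
Lemma deriv_word u (W := word (1 : int) u) :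
  [/\ 2 * (pword u 0 0)^`().[1] = W 1 0 + W 0 1 + (size u)%:R * W 0 0,
      2 * (pword u 0 1)^`().[1] =
        W 1 1 - W 0 0 - W 0 1 + (size u)%:R * W 0 1,
      2 * (pword u 1 0)^`().[1] =
        W 1 0 + W 1 1 - W 0 0 + (size u)%:R * W 1 0
    & 2 * (pword u 1 1)^`().[1] = - W 0 1 - W 1 0 + (size u)%:R * W 1 1].
Proof.
rewrite /W {W}; elim: u => [|b u [e1 e2 e3 e4]].
  by rewrite !mxE /= -!polyC_natr !derivC hornerC.
have E i j : (pword u i j).[1] = word (1 : int) u i j by exact: horner_word.
rewrite [size (_ :: _)]/= !word_cons.
case: b => /=; rewrite ?derivD ?derivM ?derivX;
  rewrite ?hornerD ?hornerM ?hornerX ?hornerC !E.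
all: by move: e1 e2 e3 e4; rewrite -natr1; set m := _%:R => e1 e2 e3 e4; split; lra.
Qed.

(** As deg P_u = n + 2, the asymmetry of the integer matrix is the exact
    obstruction to the identity of [palindromic_deriv]. *)
Lemma deriv_wpoly u : 2 * (wpoly u)^`().[1] =
  (size u).+2%:R * (wpoly u).[1] + (word 1 u 1 0 - word 1 u 0 1).
Proof.
have [e1 e2 e3 e4] := deriv_word u.
rewrite horner_wpoly /wpoly /wform.
rewrite !(derivD, derivM, derivX, derivXn).
rewrite !(hornerD, hornerM, hornerMn, hornerXn, hornerX, hornerC) !horner_word.
rewrite !expr1n.
by move: e1 e2 e3 e4; rewrite -!natr1; set m := _%:R => e1 e2 e3 e4; lra.
Qed.

Lemma palindromic_wpoly u :
  palindromic (wpoly u) <-> word (1 : int) u 0 1 = word 1 u 1 0.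
Proof.
split=> [p|/mirror_fixed e]; last by rewrite /palindromic recip_wpoly e.
have := palindromic_deriv p; rewrite size_wpoly deriv_wpoly -[RHS]addr0.
by move/addrI/eqP; rewrite subr_eq0 => /eqP ->.
Qed.

(** * The condition r^2 = -1 *)

(** The determinant 1 gives (a + b)^2 + 1 = (a + b)(b - c) + a m with m = a + b +
    c + d, and makes a + b prime to m; and |b - c| < m because a, d > 0. *)
Lemma dvd_wform_sym u :
  ((wform 1 u)%R %| ((word 1 u 0 0 + word 1 u 0 1) ^+ 2 + 1)%R)%Z <->
  word (1 : int) u 0 1 = word 1 u 1 0.
Proof.
have := word1_det u; have := word1_pos u; rewrite /wform expr1n !mul1r.
move: (word _ _ 0 0) (word _ _ 0 1) (word _ _ 1 0) (word _ _ 1 1) => a b c d.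
move=> [a0 b0 c0 d0] det.
have E : (a + b) ^+ 2 + 1 = (a + b) * (b - c) + a * (a + (b + c) + d).
  by rewrite -[X in _ + X = _]det; ring.
have co : coprimez (a + (b + c) + d) (a + b).
  apply/coprimezP; exists (- b, b + d) => /=.
  by rewrite -[RHS]det; ring.
split=> [|bc]; last by rewrite E bc subrr mulr0 add0r dvdz_mull.
rewrite E => h; have {h} : (a + (b + c) + d %| (a + b) * (b - c))%Z.
  by move: h; rewrite rpredDr // dvdz_mull.
rewrite Gauss_dvdzr // => /dvdzP[k]; have [->|] := eqVneq k 0; first by lia.
nia.
Qed.

Lemma palindromic_wpoly_dvd u : palindromic (wpoly u) <->
  ((wform 1 u)%R %| ((word 1 u 0 0 + word 1 u 0 1) ^+ 2 + 1)%R)%Z.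
Proof. by apply: iff_trans (palindromic_wpoly u) _; rewrite -dvd_wform_sym. Qed.

(** * Coordinates of flat vectors *)

Lemma palindromic1 : palindromic 1.
Proof.
apply/eqP/polyP => i; rewrite coef_poly size_poly1 !coef1.
by case: i.
Qed.

Definition flat_coord (R : comNzRingType) (t : R) v i :=
  t * word t v i 0 + word t v i 1.

Lemma flat_coord_cons (R : comNzRingType) (t : R) b v i : flat_coord t (b :: v) i =
  if b then (if i == 0 then t * flat_coord t v 0 + flat_coord t v 1
             else flat_coord t v 1)
  else (if i == 0 then t * flat_coord t v 0
        else t * flat_coord t v 0 + flat_coord t v 1).
Proof. by rewrite /flat_coord !word_cons; case: b; case: ifP => _; ring. Qed.

Lemma dvdz_sqr1_shift (m x k : int) :
  (m %| (x + k * m) ^+ 2 + 1)%Z = (m %| x ^+ 2 + 1)%Z.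
Proof.
rewrite (_ : (x + k * m) ^+ 2 + 1 = (2 * x * k + k * k * m) * m + (x ^+ 2 + 1)).
  by rewrite rpredDl ?dvdz_mull.
by ring.
Qed.

Lemma flat_coord_LE (R : comNzRingType) (t : R) u :
  flat_coord t (false :: u) 1 = wform t u.
Proof. by rewrite /flat_coord /wform !word_cons /=; ring. Qed.

Lemma flat_coord_RE (R : comNzRingType) (t : R) u :
  flat_coord t (true :: u) 0 = wform t u.
Proof. by rewrite /flat_coord /wform !word_cons /=; ring. Qed.

Lemma palindromic_bottom u : let v := false :: u in palindromic (wpoly u) <->
  (flat_coord 1 v 1%R %| (flat_coord 1 v 0%R ^+ 2 + 1)%R)%Z.
Proof.
rewrite /= flat_coord_LE /flat_coord !word_cons /= !mul1r.
exact: palindromic_wpoly_dvd.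
Qed.

(** Here a + b is congruent to minus the lower coordinate modulo the upper one;
    the square does not see the sign. *)
Lemma palindromic_top u : let v := true :: u in palindromic (wpoly u) <->
  (flat_coord 1 v 0%R %| (flat_coord 1 v 1%R ^+ 2 + 1)%R)%Z.
Proof.
rewrite /= flat_coord_RE -(dvdz_sqr1_shift _ _ (-1)) -sqrrN.
have -> : - (flat_coord 1 (true :: u) 1 + -1 * wform 1 u)
    = word (1 : int) u 0 0 + word 1 u 0 1.
  by rewrite /flat_coord /wform !word_cons /=; ring.
exact: palindromic_wpoly_dvd.
Qed.

(** Initial letters R leave the lower coordinate unchanged and shift the upper
    one by multiples of it, so only the part of v from the first L on matters.
    [flat_coord_top] is the same argument with the letters exchanged, except
    that each initial L contributes a factor t. *)
Lemma flat_coord_bottom v : exists f : {poly int},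
  [/\ f`_0 = 1, f \is monic,
      palindromic f <-> (flat_coord 1 v 1%R %| (flat_coord 1 v 0%R ^+ 2 + 1)%R)%Z
    & forall (F : fieldType) (t : F), flat_coord t v 1 = ev t f].
Proof.
elim: v => [|[] v [f [f0 fm fp fe]]].
- exists 1; rewrite coef1 monic1 palindromic1; split=> // [|F t].
    by rewrite /flat_coord !mxE /= mulr0 add0r dvd1z.
  by rewrite ev1 /flat_coord !mxE /= mulr0 add0r.
- exists f; split=> // [|F t]; last by rewrite -fe /flat_coord !word_cons.
  by rewrite fp -(dvdz_sqr1_shift _ _ 1) !flat_coord_cons /= !mul1r.
- exists (wpoly v); rewrite wpoly_coef0 wpoly_monic.
  split=> // [|F t]; first exact: palindromic_bottom.
  by rewrite flat_coord_LE ev_wpoly.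
Qed.

Lemma flat_coord_top v : exists (k : nat) (f : {poly int}),
  [/\ f`_0 = 1, f \is monic,
      palindromic f <-> (flat_coord 1 v 0%R %| (flat_coord 1 v 1%R ^+ 2 + 1)%R)%Z
    & forall (F : fieldType) (t : F), flat_coord t v 0 = t ^+ k * ev t f].
Proof.
elim: v => [|[] v [k [f [f0 fm fp fe]]]].
- exists 1%N, 1; rewrite coef1 monic1 palindromic1; split=> // [|F t].
    by rewrite /flat_coord !mxE /= mul1r addr0 dvd1z.
  by rewrite ev1 /flat_coord !mxE /= addr0.
- exists 0%N, (wpoly v); rewrite wpoly_coef0 wpoly_monic.
  split=> // [|F t]; first exact: palindromic_top.
  by rewrite flat_coord_RE ev_wpoly mul1r.
- exists k.+1, f; split=> // [|F t].
    by rewrite fp -(dvdz_sqr1_shift _ _ 1) !flat_coord_cons /= !mul1r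
      [flat_coord _ v 0 + _]addrC.
  by rewrite exprS -mulrA -fe flat_coord_cons.
Qed.

(** * From continued fractions to words *)

Fixpoint cf_letters (a : seq int) : seq bool :=
  if a is [:: c, d & a'] then
    nseq `|c|%N true ++ nseq `|d|%N false ++ cf_letters a'
  else [::].

Lemma word_nseq (R : comNzRingType) (t : R) b n :
  word t (nseq n b) = letter t b ^+ n.
Proof. by elim: n => [|n IH] //=; rewrite IH exprS. Qed.

Lemma Mmx_letters a (F : fieldType) (t : F) : t != 0 -> pos_cf a ->
  exists n : int, Mmx t a = t ^ n *: word t (cf_letters a).
Proof.
move=> t0 /[dup] /pos_cf_ge0; have [n] := ubnP (size a).
elim: n a => // n IH [|c [|d a]] //= an.
  by move=> _ _; exists 0; rewrite expr0z scale1r.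
move=> /and3P[c0 d0 ap]; rewrite pos_cf_cons2 => /and4P[_ _ a1 a2].
have [||k ->] := IH a _ ap.
- by move: an => /=; lia.
- rewrite /pos_cf a2 /=; case: (a) a1 ap => //= x e /andP[_ ->] /andP[-> _].
  by [].
exists (k - `|d|%:Z); rewrite !word_cat !word_nseq.
rewrite -[in LHS](gez0_abs c0) -[in LHS](gez0_abs d0) -!exprnP.
have -> : Rmx t = letter t true by [].
have -> : Lmx t = t^-1 *: letter t false.
  by apply: matrix2P; rewrite !mxE /=; field.
rewrite exprZn -!scalerAr -scalerAl scalerA; congr (_ *: _).
  by rewrite exprVn exprnN -expfzDr.
by rewrite -mulrA.
Qed.

Lemma pos_cf_behead2 c d a : pos_cf [:: c, d & a] -> pos_cf a.
Proof.
rewrite pos_cf_cons2 => /and4P[_ _ a1 a2]; rewrite /pos_cf a2 /=.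
by case: a a1 {a2} => //= x e /andP[/(le_trans ler01) -> ->].
Qed.

Lemma word1_nseq n v j : 
  (word (1 : int) (nseq n false ++ v) 0 j = word 1 v 0 j) *
  (word (1 : int) (nseq n false ++ v) 1 j = word 1 v 1 j + n%:R * word 1 v 0 j) *
  (word (1 : int) (nseq n true ++ v) 0 j = word 1 v 0 j + n%:R * word 1 v 1 j) *
  (word (1 : int) (nseq n true ++ v) 1 j = word 1 v 1 j).
Proof.
elim: n => [|n IH]; first by rewrite !mul0r !addr0.
rewrite ![_ ++ _]/= !word_cons /= !IH -natr1.
by do !split; ring.
Qed.

(** The words act on the point at infinity, whose column is (1, 0)^T.  For the
    empty expansion this still gives the right value, since 0^-1 = 0. *)
Lemma cf_val_letters a : pos_cf a ->
  cf_val a = (word (1 : int) (cf_letters a) 0 0)%:~R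
             / (word 1 (cf_letters a) 1 0)%:~R.
Proof.
have [n] := ubnP (size a); elim: n a => // n IH [|c [|d a]] //= an.
  by move=> _; rewrite !mxE /= invr0 mulr0.
move=> /[dup] /pos_cf_behead2 ap; rewrite pos_cf_cons2 => /and4P[c0 d0 _ _].
rewrite !cf_val_cons IH //; last by move: an => /=; lia.
have [a0 _ b0 _] := word1_pos (cf_letters a).
have {IH an} := word1_pos (nseq `|d|%N false ++ cf_letters a).
have d0' : 0 <= d := le_trans ler01 d0.
rewrite !word1_nseq !natz !gez0_abs //.
move: (word 1 _ 0 0) (word 1 _ 1 0) a0 b0 => x y x0 y0 [_ _ _ _].
have x0' : x%:~R != 0 :> rat by rewrite intr_eq0 gt_eqF.
have z0 : (y + d * x)%:~R != 0 :> rat.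
  by rewrite intr_eq0 gt_eqF // ltr_wpDl // mulr_gt0 // (lt_le_trans ltr01).
rewrite !(rmorphD, rmorphM) /= in z0 *.
rewrite invf_div; field.
by rewrite z0 x0'.
Qed.

(** The last letter L is set aside because it sends both (1, 1 - q)^T and (1, 0)^T
    to simpler vectors: (q, 1)^T and (q, q)^T. *)
Lemma cf_letters_rcons a : pos_cf a -> a != [::] ->
  exists v, cf_letters a = rcons v false.
Proof.
have [n] := ubnP (size a); elim: n a => // n IH [|c [|d a]] // an.
move=> /[dup] /pos_cf_behead2 ap; rewrite pos_cf_cons2 => /and4P[c0 d0 _ _] _.
suff [v ->] : exists v,
    cf_letters [:: c, d & a] = nseq `|c|%N true ++ rcons v false.
  by exists (nseq `|c|%N true ++ v); rewrite rcons_cat.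
have [->|aN] := eqVneq a [::].
  exists (nseq `|d|.-1 false); rewrite /= cats0; congr cat.
  by case: d d0 {an} => // -[|m] // _; rewrite -cats1 -(nseqD _ 1) addn1.
have [|v e] := IH a _ ap aN; first by move: an => /=; lia.
by exists (nseq `|d|%N false ++ v); rewrite /= e rcons_cat.
Qed.

Lemma reduced_eq (r s r' s' : int) :
  0 < s -> 0 < s' -> coprimez r s -> coprimez r' s' ->
  r%:~R / s%:~R = r'%:~R / s'%:~R :> rat -> r = r' /\ s = s'.
Proof.
move=> s0 s0' co co' e; split.
  by have := coprimeq_num co; rewrite e coprimeq_num // !gtr0_sg // !mul1r.
by have := coprimeq_den co; rewrite e coprimeq_den // !gt_eqF // !gtr0_norm.
Qed.

(** At t = 1 the vector (t, 1)^T is (1, 1)^T, so the word recovers the fraction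
    itself; the determinant 1 makes the recovered fraction reduced. *)
Lemma flat_coord1_spec (r s : int) : 0 < r -> 0 < s -> coprimez r s ->
  let a := even_cf (r%:~R / s%:~R) in
  exists v, [/\ cf_letters a = rcons v false, flat_coord 1 v 0 = r,
                flat_coord 1 v 1 = s & s < r -> exists u, v = true :: u].
Proof.
move=> r0 s0 co a; have x0 : 0 < r%:~R / s%:~R :> rat by rewrite divr_gt0 ?ltr0z.
have [pa aN] := even_cf_pos x0.
have /and3P[_ /eqP va _] := even_cfP (r%:~R / s%:~R).
have [v e] := cf_letters_rcons pa aN; exists v.
have := cf_val_letters pa; rewrite va e !word_rcons /= !mul1r => rs.
have [h1 h2 h3 h4] := word1_pos v; have det := word1_det v.
have [||||-> ->] := reduced_eq _ _ _ _ rs => //.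
- by rewrite ltr_wpDl.
- apply/coprimezP; exists (word 1 v 1 1, - word 1 v 0 1) => /=.
  by rewrite -[RHS]det; ring.
rewrite /flat_coord !mul1r; split=> //.
case: v {e rs det} h1 h2 h3 h4 => [|[] v]; first by rewrite !mxE.
  by exists v.
have [] := word1_pos v.
by rewrite !word_cons /= !mul1r; generalize_entries v; lia.
Qed.

(** * Reciprocals and units *)

Lemma recipK (f : {poly int}) : f`_0 != 0 -> recip (recip f) = f.
Proof.
move=> f0; have sz : size (recip f) = size f by rewrite size_poly_eq // subnn.
apply/polyP => i; rewrite coef_poly sz.
have [fi|fi] := ltnP i (size f); last by rewrite nth_default.
by rewrite coef_poly ifT ?subKn //; lia.
Qed.

Lemma palindromic_recip (f : {poly int}) :
  f`_0 != 0 -> palindromic (recip f) <-> palindromic f.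
Proof.
by move=> f0; rewrite /palindromic recipK //; split=> /eqP/esym/eqP.
Qed.

Lemma recip_coef0 (f : {poly int}) : (recip f)`_0 = lead_coef f.
Proof.
rewrite coef_poly subn0 lead_coefE; case: ltnP => //.
by rewrite leqn0 size_poly_eq0 => /eqP ->; rewrite coef0.
Qed.

Lemma qunitM c c' : qunit c * qunit c' = qunit (c.1 (+) c'.1, c.2 + c'.2).
Proof.
by rewrite /qunit /= signr_addb expfzDr ?q_neq0 // mulrACA.
Qed.

Lemma qunitMA c c' f :
  qunit c * (qunit c' * f) = qunit (c.1 (+) c'.1, c.2 + c'.2) * f.
Proof. by rewrite mulrA qunitM. Qed.

Lemma qunitV c : qunit (c.1, - c.2) * qunit c = 1.
Proof. by rewrite qunitM /= addbb addNr /qunit /= !expr0z mul1r. Qed.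

Lemma qunit_q n : q ^ n = qunit (false, n).
Proof. by rewrite /qunit expr0 mul1r. Qed.

Lemma qunit_qn (n : nat) : q ^+ n = qunit (false, n%:Z).
Proof. by rewrite -qunit_q. Qed.

Lemma ev_qV (f : {poly int}) :
  ev q^-1 f = qunit (false, - (size f).-1%:Z) * (recip f)%:F.
Proof.
rewrite tofrac_ev ev_recip ?q_neq0 // qunit_qn mulrA qunitM /= addNr.
by rewrite -qunit_q mul1r.
Qed.

Lemma palindromic_sign (b : bool) (f : {poly int}) :
  palindromic ((-1) ^+ b * f) = palindromic f.
Proof.
rewrite mulr_sign; case: b; rewrite // /palindromic.
rewrite (_ : recip (- f) = - recip f) ?eqr_opp //.
apply/polyP => i; rewrite coefN !coef_poly size_polyN coefN.
by case: ifP; rewrite ?oppr0.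
Qed.

Lemma palindromic_coef0 f : palindromic f -> f != 0 -> f`_0 != 0.
Proof. by move/eqP=> e; rewrite e recip_coef0 -e lead_coef_eq0. Qed.

Lemma tofrac_sign (b : bool) : ((-1) ^+ b : {poly int})%:F = (-1) ^+ b.
Proof. exact: rmorph_sign. Qed.

(** Both polynomials have a nonzero constant term, so the exponent of the unit
    must vanish. *)
Lemma palindromic_associate c (f g : {poly int}) :
  g`_0 = 1 -> palindromic f -> g%:F = qunit c * f%:F -> palindromic g.
Proof.
move=> g0 pf; have gN0 : g != 0.
  by apply/eqP => e; move: g0; rewrite e coef0.
case: c => b n /[dup] gf.
have f0 : f`_0 != 0.
  apply: palindromic_coef0 => //; apply/eqP => e.
  by move/eqP: gf; rewrite e tofrac0 mulr0 tofrac_eq0 (negbTE gN0).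
rewrite /qunit /=; case: n {gf} => n.
  rewrite -exprnP -tofrac_sign -tofracXn -!tofracM => /eqP.
  rewrite tofrac_eq => /eqP e; move: g0; rewrite e -mulrA.
  have S (p : {poly int}) : ((-1) ^+ b * p)`_0 = (-1) ^+ b * p`_0.
    by rewrite !mulr_sign; case: (b); rewrite ?coefN.
  rewrite S coefXnM; case: n {e} => [|n] /=; last by rewrite mulr0.
  by rewrite expr0 mul1r palindromic_sign.
rewrite NegzE -exprnN => e.
have : (g * 'X^(n.+1))%:F = ((-1) ^+ b * f)%:F.
  rewrite !tofracM tofracXn tofrac_sign e -/q mulrAC.
  by rewrite divfK ?expf_neq0 ?q_neq0.
move/eqP; rewrite tofrac_eq => /eqP {}e.
have := congr1 (fun p : {poly int} => p`_0) e; rewrite coefMXn /=.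
have -> : ((-1) ^+ b * f)`_0 = (-1) ^+ b * f`_0.
  by rewrite !mulr_sign; case: (b); rewrite ?coefN.
by move/esym/eqP; rewrite mulf_eq0 signr_eq0 (negbTE f0).
Qed.

Lemma normalizes_qunit (v : 'cV[qfrac]_2) c (h : {poly int}) :
  h`_0 = 1 -> v 1 0 = qunit c * h%:F -> normalizes v ((c.1, - c.2), h).
Proof.
by move=> h0 e; rewrite /normalizes h0 eqxx e /= mulrA qunitV mul1r.
Qed.

(** * Flat and sharp vectors in terms of words *)

Lemma word_flat (F : fieldType) (t : F) v i :
  (word t (rcons v false) *m cv2 1 (1 - t)) i 0 = flat_coord t v i.
Proof.
by rewrite mulmx2E !mxE !word_rcons /= /flat_coord; ring.
Qed.

Lemma word_sharp (F : fieldType) (t : F) v i :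
  (word t (rcons v false) *m cv2 1 0) i 0 = t * (word t v i 0 + word t v i 1).
Proof.
by rewrite mulmx2E !mxE !word_rcons /=; ring.
Qed.

Lemma Mmx_flat (F : fieldType) (t : F) a v : t != 0 -> pos_cf a ->
  cf_letters a = rcons v false ->
  exists n : int,
    forall i, (Mmx t a *m cv2 1 (1 - t)) i 0 = t ^ n * flat_coord t v i.
Proof.
move=> t0 pa av; have [n ->] := Mmx_letters t0 pa; exists n => i.
by rewrite av -scalemxAl mxE word_flat.
Qed.

Lemma Mmx_sharp (F : fieldType) (t : F) a v : t != 0 -> pos_cf a ->
  cf_letters a = rcons v false ->
  exists n : int, forall i, (Mmx t a *m cv2 1 0) i 0 =
    t ^ n * (word t v i 0 + word t v i 1).
Proof.
move=> t0 pa av; have [n ->] := Mmx_letters t0 pa; exists (n + 1) => i.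
by rewrite av -scalemxAl mxE word_sharp expfzDr // mulrA.
Qed.

(** Changing the signs of the entries of the expansion amounts, up to
    diag(t, -1), to replacing t by 1/t. *)
Lemma Mmx_flatN (F : fieldType) (t : F) a v : t != 0 -> pos_cf a ->
  cf_letters a = rcons v false ->
  exists n : int, forall i, (Mmx t (map -%R a) *m cv2 1 (1 - t)) i 0 =
    if i == 0 then t ^ n * flat_coord t^-1 v 0
    else - (t ^ (n + 1) * flat_coord t^-1 v 1).
Proof.
move=> t0 pa av; have t'0 : t^-1 != 0 by rewrite invr_eq0.
have [n en] := Mmx_flat t'0 pa av; exists (- n); rewrite exprz_inv in en.
set w := _ *m _.
have Dw : mx2 t 0 0 (-1) *m w = t *: (Mmx t^-1 a *m cv2 1 (1 - t^-1)).
  rewrite /w mulmxA [_ *m Mmx _ _](D_Mmx t0 (pos_cf_ge0 pa)); last first.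
    by case/and3P: pa.
  by rewrite -mulmxA (D_flat t0) -scalemxAr.
clearbody w; have Di i := congr1 (fun A : 'cV_2 => A i 0) Dw.
have := Di 1; have := Di 0.
have scaleE (c : F) (A : 'cV[F]_2) i : (c *: A) i 0 = c * A i 0 by rewrite mxE.
rewrite /= !scaleE !en !mulmx2E !mxE /= !mul0r addr0 add0r mulN1r.
move=> /(mulfI t0) w0 w1; apply: ord2P => //=.
by rewrite addrC expfzDr // expr1z -mulrA -w1 opprK.
Qed.

(** * The three statements *)

Definition flat_shape (r s : int) (w : 'cV[qfrac]_2) :=
  exists (c c' : bool * int) (g h : {poly int}),
  [/\ g`_0 = 1, h`_0 = 1, w 0 0 = qunit c * g%:F &
   [/\ w 1 0 = qunit c' * h%:F,
      palindromic g <-> (r %| (s ^+ 2 + 1)%R)%Z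
    & palindromic h <-> (s %| (r ^+ 2 + 1)%R)%Z]].

Lemma flat_shape_pos (r s : int) : 0 < r -> 0 < s -> coprimez r s ->
  flat_shape r s (flat_vec (r%:~R / s%:~R)).
Proof.
move=> r0 s0 co; have [v [av er es _]] := flat_coord1_spec r0 s0 co.
have x0 : 0 < r%:~R / s%:~R :> rat by rewrite divr_gt0 ?ltr0z.
have [pa _] := even_cf_pos x0.
have [n en] := Mmx_flat q_neq0 pa av.
have [k [g [g0 _ gp ge]]] := flat_coord_top v.
have [h [h0 _ hp he]] := flat_coord_bottom v.
exists (false, n + k%:Z), (false, n), g, h; split=> //; last split.
- by apply: etrans (en 0) _; rewrite ge tofrac_ev mulrA qunit_q qunit_qn qunitM.
- by apply: etrans (en 1) _; rewrite he tofrac_ev qunit_q.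
- by rewrite -er -es.
- by rewrite -er -es.
Qed.

Lemma even_cfN x : 0 < x -> even_cf (- x) = map -%R (even_cf x).
Proof.
move=> x0; have [|a ea [pa _]] := @even_cf_neg (- x); first by rewrite oppr_lt0.
rewrite ea; congr map; apply: even_cf_unique.
have /and3P[_ /eqP + _] := even_cfP (- x); rewrite ea cf_valN => /oppr_inj va.
by case/and3P: pa => p1 p2 p3; rewrite /is_even_cf p1 va eqxx gt_eqF // x0 p2.
Qed.

Lemma flat_shape_neg (r s : int) : 0 < r -> 0 < s -> coprimez r s ->
  flat_shape (- r) s (flat_vec (- (r%:~R / s%:~R))).
Proof.
move=> r0 s0 co; have [v [av er es _]] := flat_coord1_spec r0 s0 co.
have x0 : 0 < r%:~R / s%:~R :> rat by rewrite divr_gt0 ?ltr0z.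
have [pa _] := even_cf_pos x0.
have [n en] := Mmx_flatN q_neq0 pa av.
have [k [g [g0 gm gp ge]]] := flat_coord_top v.
have [h [h0 hm hp he]] := flat_coord_bottom v.
exists (false, n - k%:Z - (size g).-1%:Z), (true, n + 1 - (size h).-1%:Z).
exists (recip g), (recip h).
rewrite !recip_coef0 (monicP gm) (monicP hm) /flat_vec even_cfN //.
split=> //; last split.
- apply: etrans (en 0) _; rewrite /= ge ev_qV exprVn exprnN.
  by rewrite !qunit_q !qunitMA.
- apply: etrans (en 1) _; rewrite /= he ev_qV qunit_q qunitMA /=.
  by rewrite /qunit /= expr0 expr1 mul1r mulN1r mulNr.
- apply: iff_trans (palindromic_recip _) _; rewrite ?g0 //.
  by rewrite dvdzE abszN -dvdzE -er -es.
- by apply: iff_trans (palindromic_recip _) _; rewrite ?h0 // sqrrN -er -es.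
Qed.

(** The numerator is a unit times 1 - q, which is not palindromic, while
    1^2 = -1 fails modulo 0. *)
Lemma flat_shape0 : flat_shape 0 1 (flat_vec 0).
Proof.
rewrite /flat_vec even_cf0 (Mmx_flat0 q_neq0).
exists (true, -2), (false, -1), (1 - 'X), 1; split; last split.
- by rewrite !coefE.
- by rewrite !coefE.
- rewrite mxE /= -tofrac_ev /qunit /= expr1 mulN1r mulNr -mulrN -tofracN.
  by rewrite opprB polyCN.
- by rewrite mxE /= -tofrac_ev qunit_q.
- split=> [/eqP/(congr1 (fun f : {poly int} => f`_0))|].
    rewrite recip_coef0 !coefE /= lead_coefE (_ : size _ = 2%N) ?coefE //.
    by rewrite addrC size_polyDl ?size_polyN ?size_polyX ?size_polyC.
  by rewrite dvd0z expr1n.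
- by rewrite palindromic1 dvd1z.
Qed.

Lemma flat_vec_shape (r s : int) : 0 < s -> coprimez r s ->
  flat_shape r s (flat_vec (r%:~R / s%:~R)).
Proof.
move=> s0 co; have [r0|r0|r0] := ltrgt0P r.
- exact: flat_shape_pos.
- have := @flat_shape_neg (- r) s; rewrite oppr_gt0 opprK coprimeNz.
  by rewrite rmorphN mulNr opprK; apply.
- have -> : s = 1 by move: co; rewrite r0 coprimezE /coprime gcd0n; lia.
  by rewrite r0 mul0r; apply: flat_shape0.
Qed.

(** For r/s > 1 the word starts with R.  The row (q, 1 - q) that defines the Jones
    polynomial times the matrix R is (q^2, 1), and the sharp vector contributes
    (1, 1)^T, so [wform_mirror] applies. *)
Lemma norm_jones_wpoly (r s : int) : 0 < s -> s < r -> coprimez r s ->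
  exists u, norm_jones (r%:~R / s%:~R) = recip (wpoly u) /\
    (palindromic (wpoly u) <-> (r %| (s ^+ 2 + 1)%R)%Z).
Proof.
move=> s0 sr co; have r0 := lt_trans s0 sr.
have [v [av er es]] := flat_coord1_spec r0 s0 co.
case/(_ sr) => u ev; exists u; split; last first.
  by rewrite -er -es ev; apply: palindromic_top.
set x := _ / _ in av *.
have x1 : 1 < x by rewrite ltr_pdivlMr ?ltr0z // mul1r ltr_int.
have [pa _] := even_cf_pos (lt_trans ltr01 x1).
have [n en] := Mmx_sharp q_neq0 pa av.
pose W i : {poly int} := pword v i 0 + pword v i 1.
have sE i : sharp_vec x i 0 = qunit (false, n) * (W i)%:F.
  by apply: etrans (en i) _; rewrite tofracD !tofrac_ev !ev_word qunit_q.
have W0 : (W 1)`_0 = 1.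
  rewrite -horner_coef0 hornerD !horner_word ev !word_cons /=.
  by have [-> ->] := word_at0 int u; rewrite add0r.
have := normalizes_unique (normalizes_qunit W0 (sE 1)).
move=> /(_ (sharp_norm x).1 (sharp_norm x).2); rewrite -surjective_pairing.
case/(_ (sharp_normP x)) => ec eS.
apply/eqP; rewrite -tofrac_eq norm_jonesE // recip_wpoly /Rsharp /Ssharp -ec -eS.
rewrite sE [qunit _ * (qunit _ * _)]mulrA qunitV mul1r -tofrac1 /q.
rewrite -tofracB -!tofracM -tofracD tofrac_eq.
rewrite /wpoly wform_mirror /W ev !word_cons /=; apply/eqP; ring.
Qed.

Lemma eqz_mod_opp1 (x m : int) : (x = -1 %[mod m])%Z <-> (m %| (x + 1)%R)%Z.
Proof. by rewrite -[1 in X in _ <-> X]opprK -eqz_mod_dvd; split=> /eqP. Qed.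

(** Part (1) uses that the normalization of the denominator is unique; part (2)
    allows any unit, which [palindromic_associate] controls. *)
Theorem theorem4p12 (r s : int) (s_gt0 : 0 < s) (coprime_rs : coprimez r s) :
  [/\ palindromic (Sflat (r%:~R / s%:~R)) <-> (r ^+ 2 = -1 %[mod s])%Z,
      (exists2 f : {poly int},
         palindromic f & qequiv (Rflat (r%:~R / s%:~R)) f%:F)
        <-> (s ^+ 2 = -1 %[mod r])%Z
    & 1 < r%:~R / s%:~R :> rat ->
      (palindromic (norm_jones (r%:~R / s%:~R)) <->
         (s ^+ 2 = -1 %[mod r])%Z)].
Proof.
have [c [c' [g [h [g0 h0 eR [eS pg ph]]]]]] := flat_vec_shape s_gt0 coprime_rs.
have pR := iff_trans pg (iff_sym (eqz_mod_opp1 _ _)).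
have pS := iff_trans ph (iff_sym (eqz_mod_opp1 _ _)).
split.
- have := normalizes_unique (normalizes_qunit h0 eS).
  move=> /(_ (flat_norm (r%:~R / s%:~R)).1 (flat_norm (r%:~R / s%:~R)).2).
  rewrite -surjective_pairing /Sflat => /(_ (flat_normP _)) [_ <-].
  exact: pS.
- apply: iff_trans pR; rewrite /Rflat eR mulrA qunitM; set d := (_, _).
  split=> [[f pf [e ef]]|pg']; last by exists g => //; exists d.
  apply: (@palindromic_associate (d.1 (+) e.1, - d.2 + e.2) f) => //.
  by rewrite -[RHS](qunitMA (d.1, - d.2)) -ef mulrA qunitV mul1r.
- rewrite ltr_pdivlMr ?ltr0z // mul1r ltr_int => sr.
  have [u [-> pu]] := norm_jones_wpoly s_gt0 sr coprime_rs.
  apply: iff_trans (iff_trans pu (iff_sym (eqz_mod_opp1 _ _))).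
  by apply: palindromic_recip; rewrite wpoly_coef0.
Qed.
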